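(* Let $d>1$ be an integer and let $X$ be an $\mathbb{R}^d$-valued random variable that decays quickly, is Lipschitz continuous in projection, and is radially Lipschitz continuous. Let $(X_1,X_2,\ldots)$ be a sequence of i.i.d. random variables equal in distribution to $X$, and write $X^{(n)}=(X_1,\ldots,X_n)$. Fix $\varepsilon>0$. Then there exist a constant $C$ (independent of $n$) and an integer $N$ such that for all $n\ge N$, $$ \Pr\left(\sup_{q\in\mathbb{R}^d}|\operatorname{HD}(q;X)-\operatorname{HD}(q;X^{(n)})|\leq\varepsilon\right)\geq 1-Cn^{\frac{3}{2}(d-1)}e^{-2n\varepsilon^2}. $$
   Context: Halfspace depth: for $q\in\mathbb{R}^d$, $\operatorname{HD}(q;X)=\min_{H}\Pr(X\in H)$ and $\operatorname{HD}(q;X^{(n)})=n^{-1}\min_{H}\#\{i\le n: X_i\in H\}$, where both minima are over all (closed) halfspaces $H$ of $\mathbb{R}^d$ containing $q$. For $\theta\in S^{d-1}$ (the unit sphere in $\mathbb{R}^d$), $u_\theta\in\mathbb{R}^d$ is the unit vector in direction $\theta$, $d_\theta(p)=\langle p,u_\theta\rangle$ for $p\in\mathbb{R}^d$, and $F_\theta(t)=\Pr(d_\theta(X)\le t)$ for $t\in\mathbb{R}$. For $\theta,\varphi\in S^{d-1}$, $|\theta-\varphi|$ denotes the spherical distance (the central angle between the two points). $X$ decays quickly if there are constants $\lambda>0$ (the decay rate) and $C_1>0$ such that $\Pr(|X|>R)<C_1 R^{3d-5}e^{-\lambda R^2/2}$ for all $R>1$. $X$ is Lipschitz continuous in projection if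 there is a constant $L_\pi>0$ such that for all $\theta\in S^{d-1}$ the function $t\mapsto F_\theta(t)$ is Lipschitz with constant $L_\pi$. $X$ is radially Lipschitz continuous if there is a constant $L_\theta\ge 0$ (a single number, not depending on the direction, despite the subscript) such that for every fixed $t\in\mathbb{R}$, $|F_\theta(t)-F_\varphi(t)|\le L_\theta|\theta-\varphi|$ for all $\theta,\varphi\in S^{d-1}$. *)

(* Defs.v *)
From HB Require Import structures.
From mathcomp Require Import all_boot all_order all_algebra finmap.
From mathcomp Require Import all_classical all_reals all_analysis.
Set Implicit Arguments.
Unset Strict Implicit.
Unset Printing Implicit Defensive.
Import Order.TTheory GRing.Theory Num.Theory.
Import numFieldNormedType.Exports.
Local Open Scope classical_set_scope.
Local Open Scope ring_scope.

(* Row vectors with the Borel sigma-algebra.  The topology on matrices comes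
   from the max norm, hence is the Euclidean one. *)
Notation borel_rV R d := (g_sigma_algebraType (@open 'rV[R]_d)).

Definition dot (R : realType) (d : nat) (p q : 'rV[R]_d) : R :=
  \sum_(i < d) p ord0 i * q ord0 i.

(* The library norm on 'rV[R]_d is the max norm, not the Euclidean one. *)
Definition enorm (R : realType) (d : nat) (p : 'rV[R]_d) : R :=
  Num.sqrt (dot p p).

(* A direction theta is represented by its unit vector u_theta. *)
Definition usphere (R : realType) (d : nat) : set 'rV[R]_d :=
  [set u | enorm u = 1].

Definition sphere_dist (R : realType) (d : nat) (u v : 'rV[R]_d) : R :=
  acos (dot u v).

Definition closed_halfspace (R : realType) (d : nat) : set (set 'rV[R]_d) :=
  [set H | exists (u : 'rV[R]_d) (c : R),
    u != 0 /\ H = [set p | dot p u <= c]].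

Definition halfspaces_at (R : realType) (d : nat) (q : 'rV[R]_d) :
    set (set 'rV[R]_d) :=
  [set H | closed_halfspace H /\ H q].

(* The minimum is written as an infimum, which equals it whenever it is
   attained. *)
Definition HD (dT : measure_display) (T : measurableType dT) (R : realType)
    (P : probability T R) (d : nat) (X : {RV P >-> borel_rV R d})
    (q : 'rV[R]_d) : R :=
  inf [set fine (P (X @^-1` H)) | H in halfspaces_at q].

Definition HD_sample (R : realType) (d n : nat) (x : 'I_n -> 'rV[R]_d)
    (q : 'rV[R]_d) : R :=
  n%:R^-1 * inf [set #|[pred i : 'I_n | x i \in H]|%:R | H in halfspaces_at q].

Definition proj_cdf (dT : measure_display) (T : measurableType dT)
    (R : realType) (P : probability T R) (d : nat)
    (X : {RV P >-> borel_rV R d}) (u : 'rV[R]_d) (t : R) : R :=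
  fine (P [set w | dot (X w) u <= t]).

(* The exponent is a natural number: the truncated subtraction 3d - 5 is exact
   for d >= 2. *)
Definition decays_quickly (dT : measure_display) (T : measurableType dT)
    (R : realType) (P : probability T R) (d : nat)
    (X : {RV P >-> borel_rV R d}) : Prop :=
  exists lambda C1 : R, [/\ 0 < lambda, 0 < C1 &
    forall r : R, 1 < r ->
      fine (P [set w | r < enorm (X w)]) <
        C1 * r ^+ (3 * d - 5) * expR (- (lambda * r ^+ 2 / 2))].

Definition lipschitz_in_projection (dT : measure_display)
    (T : measurableType dT) (R : realType) (P : probability T R) (d : nat)
    (X : {RV P >-> borel_rV R d}) : Prop :=
  exists L : R, 0 < L /\
    forall u, usphere u -> L.-lipschitz (proj_cdf X u).

Definition radially_lipschitz (dT : measure_display) (T : measurableType dT)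
    (R : realType) (P : probability T R) (d : nat)
    (X : {RV P >-> borel_rV R d}) : Prop :=
  exists L : R, 0 <= L /\
    forall (t : R) u v, usphere u -> usphere v ->
      `|proj_cdf X u t - proj_cdf X v t| <= L * sphere_dist u v.

Definition independent_RVs (dT dU : measure_display) (T : measurableType dT)
    (U : measurableType dU) (R : realType) (P : probability T R)
    (Xs : nat -> {RV P >-> U}) : Prop :=
  forall (J : {fset nat}) (B : nat -> set U), (forall i, measurable (B i)) ->
    P (\bigcap_(i in [set` J]) Xs i @^-1` B i) =
    (\prod_(i <- J) P (Xs i @^-1` B i))%E.

Definition equal_in_distribution (dT dU : measure_display)
    (T : measurableType dT) (U : measurableType dU) (R : realType)
    (P : probability T R) (X Y : {RV P >-> U}) : Prop :=
  forall B : set U, measurable B -> distribution P X B = distribution P Y B.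

(* Main.v *)
Require Import Defs.
From HB Require Import structures.
From mathcomp Require Import all_boot all_order all_algebra finmap.
From mathcomp Require Import all_classical all_reals all_analysis.
From mathcomp Require Import ring lra.
Set Implicit Arguments.
Unset Strict Implicit.
Unset Printing Implicit Defensive.
Import Order.TTheory GRing.Theory Num.Theory.
Import numFieldNormedType.Exports.
Local Open Scope classical_set_scope.
Local Open Scope ring_scope.

(** The depth deviation at any point is at most the supremum, over closed
    halfspaces [H], of the difference between [P(X in H)] and the empirical
    frequency of [H]: two infima over the same index set differ by at most the
    sup-distance of the functions minimized.

    For one fixed set the number of hits is binomial, and the point is that for
    a fixed [eps] the Chernoff exponent of a deviation by [eps] is strictly
    larger than [2 eps^2], uniformly in the success probability.  Indeed the
    maximum over [p] of the centered logarithmic moment generating function of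
    a Bernoulli variable is strictly below Hoeffding's [s^2 / 8] for [s > 0]
    ([bernoulli_log_mgf_max_lt]); taking [s = 4 eps], the gap can be spent on a
    smaller deviation [eps' < eps] that still has probability at most
    [exp (-2 n eps^2)] ([bernoulli_tail_rate], [count_tail_le]).

    The slack [eps - eps'] does not depend on [n], so neither does the
    discretization: finitely many pairs [A] included in [B] with
    [P(B) - P(A) <= eps - eps'] bracket all halfspaces
    ([halfspace_bracketing]).  They come from compactness of the sphere and of a
    segment of offsets, once a cube carrying almost all the mass is fixed; moving the
    offset of a halfspace by [rho] costs at most [L rho] by Lipschitz
    continuity in projection.  If none of the bracket sets deviates by more
    than [eps'], no halfspace deviates by more than [eps], and a union bound
    gives failure probability at most [C exp (-2 n eps^2)] with [C] twice the
    number of brackets ([uniform_halfspace_deviation]).  For [n >= 1] the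
    factor [n^(3/2 (d-1))] is at least [1].

    Comparing this event with the one in the theorem requires the latter to be
    measurable although it involves an uncountable supremum
    ([measurable_depth_deviation]).  The sample depth is upper semicontinuous
    in sample and point jointly and the population depth is continuous, so the
    samples for which the sample depth is somewhere too small form an open set,
    and those for which it is somewhere too large form a countable union of
    projections along compact cubes of closed sets, hence of closed sets. *)

(** * Bernoulli moment generating functions *)

Lemma ln_le_tangent (R : realType) (a y : R) : 0 < a -> 0 < y ->
  ln y <= ln a + y / a - 1.
Proof.
move=> a0 y0; have ya : 0 < y / a by rewrite divr_gt0.
have := @le_ln1Dx R (y / a - 1); rewrite (_ : 1 + (y / a - 1) = y / a); last by ring.
rewrite ln_div ?posrE// => h; have {h} : ln y - ln a <= y / a - 1 by apply: h; lra.
by lra.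
Qed.

(** The Pade bound [expR s < (2 + s) / (2 - s)], written without the division
    so that it also covers [2 <= s]. *)
Lemma pade_expR_lt (R : realType) (s : R) : 0 < s ->
  (expR s - 1) * (2 - s) < 2 * s.
Proof.
move=> s0.
pose h (x : R) : R := x * 2 - (expR x - 1) * (2 - x).
have dh (x : R) : is_derive x 1 h (1 - expR x * (1 - x)).
  by rewrite /h; apply: is_derive_eq; rewrite /GRing.scale/=; ring.
have hlt : h 0 < h s.
  apply: (@gtr0_derive1_lt_cc _ h 0 s) => //.
  - move=> x; rewrite in_itv/= => /andP[x0 xs].
    rewrite derive1E (@derive_val _ _ _ _ _ _ _ (dh x)).
    have := @expR_gt1Dx R (- x); rewrite oppr_eq0 gt_eqF// => /(_ isT).
    rewrite expRN => e1.
    have : expR x * (1 - x) < expR x * (expR x)^-1 by rewrite ltr_pM2l ?expR_gt0.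
    by rewrite mulfV ?gt_eqF ?expR_gt0// subr_gt0.
  - apply: continuous_subspaceT => x.
    by apply: differentiable_continuous; apply/derivable1_diffP.
  - by rewrite in_itv/= lexx ltW.
  - by rewrite in_itv/= lexx ltW.
by move: hlt; rewrite /h expR0; lra.
Qed.

(** The maximum over [p] of [ln (1 - p + p * expR s) - s * p], attained where
    [1 - p + p * expR s = A]. *)
Definition bernoulli_log_mgf_max (R : realType) (s : R) : R :=
  let A := (expR s - 1) / s in ln A + A^-1 - 1.

(** The tangent to [ln] at [A] has slope [A^-1], and
    [p * (expR s - 1) / A = s * p], so the dependence on [p] is exactly the
    linear term. *)
Lemma bernoulli_mgf_le (R : realType) (s p : R) : 0 < s -> 0 <= p <= 1 ->
  1 - p + p * expR s <= expR (bernoulli_log_mgf_max s + s * p).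
Proof.
move=> s0 /andP[p0 p1].
have E0 : 0 < expR s - 1 by rewrite subr_gt0 expR_gt1.
have A0 : 0 < (expR s - 1) / s by rewrite divr_gt0.
have y0 : 0 < 1 - p + p * expR s by nra.
rewrite -[leLHS]lnK ?posrE// ler_expR.
apply: (le_trans (ln_le_tangent A0 y0)).
rewrite /bernoulli_log_mgf_max le_eqVlt; apply/orP; left; apply/eqP.
by field; rewrite !gt_eqF.
Qed.

(** With [A = (expR s - 1) / s], [a = A - 1] and [b = s * A - a], the derivative
    of the left side is [a * b / (s * A^2)] and that of the right side is
    [(a + b)^2 / (4 * s * A^2)].  Their difference is a square that vanishes
    only for [a = b], which the Pade bound excludes, so the gap is strictly
    increasing; and it tends to [0] at [0]. *)
Lemma bernoulli_log_mgf_max_lt (R : realType) (s : R) : 0 < s ->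
  bernoulli_log_mgf_max s < s ^+ 2 / 8.
Proof.
(* The gap minus [1], with the logarithm of the quotient [A] split. *)
pose g (x : R) : R := x ^+ 2 * 8^-1 - ln (expR x - 1) + ln x
  - x * (expR x - 1)^-1.
have E0 (x : R) : 0 < x -> 0 < expR x - 1 by move=> ?; rewrite subr_gt0 expR_gt1.
have gE (x : R) : 0 < x -> x ^+ 2 / 8 - bernoulli_log_mgf_max x = g x + 1.
  move=> x0; rewrite /bernoulli_log_mgf_max /g ln_div ?posrE ?E0//.
  by rewrite invf_div; ring.
have dg (x : R) : 0 < x -> is_derive x 1 g
  ((2 * (expR x - 1) - 2 * x - x * (expR x - 1)) ^+ 2
     / (4 * x * (expR x - 1) ^+ 2)).
  move=> x0.
  have Ex := E0 _ x0.
  have Ex' : (expR x - 1) != 0 by rewrite gt_eqF.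
  have d1 : is_derive (expR x - 1) 1 (@ln R) (expR x - 1)^-1 by exact: is_derive1_ln.
  have d2 := is_derive1_ln x0.
  have d3 : is_derive x 1 (fun x : R => expR x - 1) (expR x).
    by apply: is_derive_eq; rewrite oppr0 addr0.
  have d4 : is_derive x 1 (fun x : R => ln (expR x - 1)) ((expR x - 1)^-1 * expR x).
    exact: (@is_derive1_comp _ (@ln R) (fun x : R => expR x - 1)).
  have d5 := @is_deriveV _ (fun x : R => expR x - 1) x (expR x) 1 Ex' d3.
  have d6 : is_derive x 1 (fun x : R => x ^+ 2 * 8^-1) (x / 4).
    by apply: is_derive_eq; rewrite /GRing.scale/=; field.
  have d7 := is_deriveB (is_deriveD (is_deriveB d6 d4) d2)
     (is_deriveM (is_derive_id x (1:R)) d5).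

  apply: (is_derive_eq d7); rewrite /GRing.scale/=.
  rewrite -[id x]/x; clear -x0 Ex; move: (expR x) Ex => E Ex.
  by field; rewrite (gt_eqF Ex) (gt_eqF x0).

(* This bound replaces the limit of the gap at [0], where [g] is singular. *)
have glow (x : R) : 0 < x -> - x <= g x + 1.
  move=> x0; rewrite /g.
  have Ex := E0 _ x0.
  have e1 : ln (expR x - 1) <= x + ln x.
    rewrite -{2}(expRK x) -lnM ?posrE ?expR_gt0//.
    rewrite ler_ln ?posrE ?mulr_gt0 ?expR_gt0//.
    have := @expR_ge1Dx R (- x); rewrite expRN => e2.
    have : expR x * (1 - x) <= expR x * (expR x)^-1 by rewrite ler_pM2l ?expR_gt0.
    rewrite mulfV ?gt_eqF ?expR_gt0//; lra.
  have e3 : x / (expR x - 1) <= 1.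
    by rewrite ler_pdivrMr// mul1r; have := @expR_ge1Dx R x; lra.
  have := sqr_ge0 x; lra.
clearbody g.
have gmono (x y : R) : 0 < x -> x < y -> g x < g y.
  move=> x0 xy; apply: (@gtr0_derive1_lt_cc _ g x y).
  - move=> z; rewrite in_itv/= => /andP[xz _].
    by have [] := dg _ (lt_trans x0 xz).
  - move=> z; rewrite in_itv/= => /andP[xz _].
    have z0 := lt_trans x0 xz.
    rewrite derive1E; have [_ ->] := dg _ z0.
    have Ez := E0 _ z0.
    apply: divr_gt0; last by rewrite !mulr_gt0// exprn_gt0.
    rewrite exprn_even_gt0//= lt_eqF//.
    by have := pade_expR_lt z0; lra.
  - apply: continuous_in_subspaceT => z; rewrite inE/= in_itv/= => /andP[xz _].
    have z0 := lt_le_trans x0 xz.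
    by apply: differentiable_continuous; apply/derivable1_diffP; have [] := dg _ z0.
  - by rewrite in_itv/= lexx ltW.
  - by rewrite in_itv/= lexx ltW.
  - exact: xy.

move=> s0; rewrite -subr_gt0 gE//.
have h0 : 0 < s / 2 by lra.
have hs : s / 2 < s by lra.
have h1 : 0 <= g (s / 2) + 1.
  apply/ler_addgt0Pr => e e0.
  have m0 : 0 < Num.min e (s / 4) by rewrite lt_min e0/=; lra.
  have m1 : Num.min e (s / 4) <= e by rewrite ge_min lexx.
  have m2 : Num.min e (s / 4) <= s / 4 by rewrite ge_min lexx orbT.
  have := glow _ m0; have := gmono (Num.min e (s / 4)) (s / 2) m0; lra.
have := gmono _ _ h0 hs; lra.
Qed.

(** At Hoeffding's optimal parameter [s = 4 * eps] the strict gap leaves room to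
    lower the deviation from [eps] to [eps'] at the rate [2 * eps^2]. *)
Lemma bernoulli_tail_rate (R : realType) (eps : R) : 0 < eps ->
  exists2 eps' : R, eps' < eps & forall p : R, 0 <= p <= 1 ->
    (1 - p + p * expR (4 * eps)) * expR (- (4 * eps * (p + eps'))) <=
    expR (- (2 * eps ^+ 2)).
Proof.
move=> e0; have s0 : 0 < 4 * eps by lra.
set k := bernoulli_log_mgf_max (4 * eps).
have klt : k < 2 * eps ^+ 2.
  by have := bernoulli_log_mgf_max_lt s0; rewrite -/k exprMn; lra.
exists ((k + 2 * eps ^+ 2) / (4 * eps)).
  rewrite ltr_pdivrMr//; have -> : eps * (4 * eps) = 4 * eps ^+ 2 by ring.
  by lra.
move=> p p01.
apply: le_trans (ler_wpM2r (expR_ge0 _) (bernoulli_mgf_le s0 p01)) _.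
rewrite -expRD ler_expR -/k le_eqVlt; apply/orP; left; apply/eqP.
by field; rewrite gt_eqF.
Qed.

(** * Chernoff bound for hit counts *)

Lemma le_measure_bigsetU (d : measure_display) (T : measurableType d)
    (R : realType) (P : probability T R) (I : choiceType) (s : seq I)
    (A : I -> set T) :
  (forall i, measurable (A i)) ->
  (P (\bigcup_(i in [set` s]) A i) <= \sum_(i <- s) P (A i))%E.
Proof.
move=> mA; rewrite bigcup_seq; elim: s => [|i s IH].
  by rewrite !big_nil measure0.
rewrite !big_cons; apply: le_trans (leeD2l _ IH).
by apply: measureU2 => //; apply: bigsetU_measurable.
Qed.

Definition count_in (U : Type) (n : nat) (x : 'I_n -> U) (A : set U) : nat :=
  #|[pred i : 'I_n | x i \in A]|.

Section Chernoff.
Context (dT dU : measure_display) (T : measurableType dT)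
  (U : measurableType dU) (R : realType) (P : probability T R)
  (Xs : nat -> {RV P >-> U}) (A : set U).
Hypothesis mA : measurable A.

(** The event that the hits of [A] among the first [n] variables are exactly
    those prescribed by [f].  Indices range over a finite set of naturals, the
    form in which independence is stated. *)
Definition hit_pattern (n : nat) (f : {ffun 'I_n -> bool}) : set T :=
  \bigcap_(i in [set` [fset k in iota 0 n]%fset])
    Xs i @^-1` (if [exists j : 'I_n, (j == i :> nat) && f j] then A else ~` A).

Lemma measurable_hit_pattern n (f : {ffun 'I_n -> bool}) :
  measurable (hit_pattern f).
Proof.
apply: fin_bigcap_measurable => [|i _]; first exact: finite_fset.
by apply: measurable_funPTI => //; case: ifP => _ //; exact: measurableC.
Qed.

Lemma hit_patternP n (w : T) :
  hit_pattern [ffun i : 'I_n => Xs i w \in A] w.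
Proof.
move=> i; rewrite /= in_fset/= mem_iota add0n => /= lin.
case: ifPn => [/existsP[j /andP[/eqP <-]]|/existsPn/(_ (Ordinal lin))/=].
  by rewrite ffunE inE.
by rewrite eqxx/= ffunE notin_setE.
Qed.

Lemma count_tail_setE n (c : R) :
  [set w | c < (count_in (fun i : 'I_n => Xs i w) A)%:R] =
  \bigcup_(f in [set` [seq f : {ffun 'I_n -> bool} <- index_enum _
                        | c < #|[pred i | f i]|%:R]])
    hit_pattern f.
Proof.
apply/seteqP; split => w /=.
  move=> cw; exists [ffun i : 'I_n => Xs i w \in A]; last exact: hit_patternP.
  rewrite /= mem_filter mem_index_enum andbT.
  rewrite (_ : #|_| = count_in (fun i : 'I_n => Xs i w) A)//.
  by apply: eq_card => i; rewrite unfold_in/= ffunE.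
move=> [f]; rewrite /= mem_filter mem_index_enum andbT => cf fw.
rewrite (_ : count_in _ _ = #|[pred i | f i]|)//; apply: eq_card => i.
have := fw i; rewrite /= in_fset/= mem_iota add0n ltn_ord => /(_ isT).
have -> : [exists j : 'I_n, (j == i :> nat) && f j] = f i.
  apply/existsP/idP => [[j /andP[/eqP/val_inj ->]]//|fi].
  by exists i; rewrite eqxx.
rewrite !unfold_in/= => wA; case: (f i) wA => wA; [exact/mem_set|exact/memNset].
Qed.

Lemma measurable_count_tail n (c : R) :
  measurable [set w | c < (count_in (fun i : 'I_n => Xs i w) A)%:R].
Proof.
rewrite count_tail_setE; apply: fin_bigcup_measurable => // f _.
exact: measurable_hit_pattern.
Qed.

Hypothesis Xs_indep : independent_RVs Xs.
Variable p : R.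
Hypothesis PA : forall i, P (Xs i @^-1` A) = p%:E.

Lemma prob_hit_pattern n (f : {ffun 'I_n -> bool}) :
  P (hit_pattern f) = (\prod_(i < n) (if f i then p else 1 - p))%:E.
Proof.
rewrite /hit_pattern Xs_indep; last first.
  by move=> i; case: ifP => _ //; exact: measurableC.
under eq_bigr => i _.
  rewrite (_ : P _ = (if [exists j : 'I_n, (j == i :> nat) && f j]
    then p else 1 - p)%:E); last first.
    case: ifP => _; first exact: PA.
    rewrite preimage_setC probability_setC; last exact: measurable_funPTI.
    by rewrite PA EFinB.
  over.
rewrite (perm_big (iota 0 n)); last first.
  apply: uniq_perm; [exact: fset_uniq | exact: iota_uniq |].
  by move=> k; rewrite in_fset.
rewrite -[iota 0 n]/(iota 0 n) -{1}(subn0 n) -/(index_iota 0 n) big_mkord.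
rewrite (eq_bigr (fun i : 'I_n => (if f i then p else 1 - p)%:E)).
  by elim/big_ind2 : _ => // x1 x2 y1 y2 -> ->; rewrite EFinM.
move=> i _; congr (if _ then _ else _)%:E.
apply/existsP/idP => [[j /andP[/eqP/val_inj ->]]//|fi].
by exists i; rewrite eqxx.
Qed.

(** Exponential Markov inequality carried out on the finitely many hit patterns:
    each pattern with more than [n * c] hits has its probability multiplied by
    a factor [expR (s * (hits - n * c)) >= 1], and the sum over all patterns
    factorizes. *)
Lemma count_tail_le (s c : R) (n : nat) : 0 <= s ->
  (P [set w | (n%:R * c < (count_in (fun i : 'I_n => Xs i w) A)%:R)%R] <=
   (((1 - p + p * expR s) * expR (- (s * c))) ^+ n)%:E)%E.
Proof.
move=> s0.
have /andP[p0 p1] : 0 <= p <= 1.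
  rewrite -!lee_fin -(PA 0) measure_ge0/= probability_le1//.
  exact: measurable_funPTI.
rewrite count_tail_setE.
apply: le_trans (le_measure_bigsetU _ _ _) _; first exact: measurable_hit_pattern.
rewrite big_filter.
under eq_bigr do rewrite prob_hit_pattern.
rewrite sumEFin lee_fin.
have -> : ((1 - p + p * expR s) * expR (- (s * c))) ^+ n =
  \sum_(f : {ffun 'I_n -> bool})
    expR (- (s * c)) ^+ n * \prod_(i < n) (if f i then p * expR s else 1 - p).
  rewrite -big_distrr/=.
  rewrite -(bigA_distr_bigA (fun (i : 'I_n) b => if b then p * expR s else 1 - p)).
  under [in RHS]eq_bigr do rewrite big_bool/=.
  by rewrite prodr_const card_ord -exprMn addrC mulrC [p * _ + _]addrC.
rewrite big_mkcond/=; apply: ler_sum => f _.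
have prod0 : 0 <= \prod_(i < n) (if f i then p * expR s else 1 - p).
  by apply: prodr_ge0 => i _; case: ifP => _; rewrite ?mulr_ge0 ?expR_ge0// subr_ge0.
case: ifPn => [cf|_]; last by rewrite mulr_ge0// exprn_ge0// expR_ge0.
have -> : \prod_(i < n) (if f i then p * expR s else 1 - p) =
   (\prod_(i < n) (if f i then p else 1 - p)) * expR (#|[pred i | f i]|%:R * s).
  rewrite expRM_natl -prodr_const [X in _ = _ * X]big_mkcond/= -big_split/=.
  by apply: eq_bigr => i _; rewrite unfold_in; case: (f i); rewrite ?mulr1.
rewrite mulrCA -expRM_natl -expRD ler_peMr//.
  apply: prodr_ge0 => i _; case: ifP => _ //; by rewrite subr_ge0.
rewrite -[leLHS]expR0 ler_expR.
have -> : n%:R * - (s * c) + #|[pred i | f i]|%:R * s =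
  s * (#|[pred i | f i]|%:R - n%:R * c) by ring.
by rewrite mulr_ge0// subr_ge0 ltW.
Qed.

End Chernoff.

(** * Halfspaces with unit normal *)

Section Euclid.
Context (R : realType) (d : nat).
Implicit Types p q u v : 'rV[R]_d.

Definition halfspace u (t : R) : set 'rV[R]_d := [set p | dot p u <= t].

Lemma dotDl p q u : dot (p + q) u = dot p u + dot q u.
Proof.
by rewrite /dot -big_split; apply: eq_bigr => i _; rewrite mxE mulrDl.
Qed.

Lemma dotNl p u : dot (- p) u = - dot p u.
Proof. by rewrite /dot -sumrN; apply: eq_bigr => i _; rewrite mxE mulNr. Qed.

Lemma dotBl p q u : dot (p - q) u = dot p u - dot q u.
Proof. by rewrite dotDl dotNl. Qed.

Lemma dotC p u : dot p u = dot u p.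
Proof. by apply: eq_bigr => i _; rewrite mulrC. Qed.

Lemma dotZr (a : R) p u : dot p (a *: u) = a * dot p u.
Proof. by rewrite /dot big_distrr; apply: eq_bigr => i _; rewrite mxE mulrCA. Qed.

Lemma mx_entry_le_norm (m n : nat) (M : 'M[R]_(m, n)) i j : `|M i j| <= `|M|.
Proof.
by rewrite [leRHS]/Num.norm/= mx_normrE; apply: (le_bigmax _ _ (i, j)).
Qed.

Lemma norm_dot_le p u : `|dot p u| <= d%:R * (`|p| * `|u|).
Proof.
apply: le_trans (ler_norm_sum _ _ _) _.
apply: le_trans (_ : _ <= \sum_(i < d) `|p| * `|u|) _.
  by apply: ler_sum => i _; rewrite normrM ler_pM// mx_entry_le_norm.
by rewrite sumr_const card_ord mulr_natl.
Qed.

Lemma dot_ge0 u : 0 <= dot u u.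
Proof. by apply: sumr_ge0 => i _; rewrite -expr2 sqr_ge0. Qed.

Lemma dot_eq0 u : (dot u u == 0) = (u == 0).
Proof.
rewrite /dot psumr_eq0 => [|i _]; last by rewrite -expr2 sqr_ge0.
apply/allP/eqP => [u0|-> i _]; last by rewrite /= mxE mul0r eqxx.
apply/rowP => i; rewrite mxE; apply/eqP.
by have := u0 i (mem_index_enum i); rewrite /= -expr2 sqrf_eq0.
Qed.

Lemma usphereE u : usphere u <-> dot u u = 1.
Proof.
rewrite /usphere/= /enorm; split => [h|->]; last by rewrite sqrtr1.
by rewrite -(sqr_sqrtr (dot_ge0 u)) h expr1n.
Qed.

Lemma usphere_norm_le1 u : usphere u -> `|u| <= 1.
Proof.
move=> /usphereE u1; rewrite [leLHS]/Num.norm/= mx_normrE.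
apply/bigmax_leP; split=> // -[i j] _; rewrite /= (ord1 i).
rewrite -(@expr_le1 _ 2%N)// real_normK ?num_real// -u1 /dot (bigD1 j)//= -expr2.
by rewrite lerDl sumr_ge0// => k _; rewrite -expr2 sqr_ge0.
Qed.

Lemma usphere_norm_dot_le p u : usphere u -> `|dot p u| <= d%:R * `|p|.
Proof.
move=> u1; apply: le_trans (norm_dot_le p u) _.
by rewrite ler_wpM2l// ler_piMr// usphere_norm_le1.
Qed.

Lemma cvg_dot (T : Type) (F : set_system T) {FF : Filter F}
    (f g : T -> 'rV[R]_d) (a b : 'rV[R]_d) :
  f x @[x --> F] --> a -> g x @[x --> F] --> b -> dot (f x) (g x) @[x --> F] --> dot a b.
Proof.
move=> fa gb; apply: cvg_big; first exact: add_continuous.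
move=> i _; apply: cvgM.
  by apply: (@cvg_comp _ _ _ f (fun M : 'rV[R]_d => M ord0 i) _ _ _ fa);
    exact: coord_continuous.
by apply: (@cvg_comp _ _ _ g (fun M : 'rV[R]_d => M ord0 i) _ _ _ gb);
    exact: coord_continuous.
Qed.

Lemma halfspace_closed u t : closed (halfspace u t).
Proof.
apply: (@closed_comp _ _ (fun p => dot p u) [set x | x <= t]).
  by move=> p _; apply: (@cvg_dot _ (nbhs p) _ id (fun=> u));
    [exact: cvg_id | exact: cvg_cst].
exact: closed_le.
Qed.

Lemma compact_usphere : compact (@usphere R d).
Proof.
apply: bounded_closed_compact.
  exists 1; split; first exact: num_real.
  by move=> x x1 u u1; exact: le_trans (usphere_norm_le1 u1) (ltW x1).
have -> : @usphere R d = (fun u => dot u u) @^-1` [set x | x = 1].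
  by apply/seteqP; split => u /usphereE.
apply: closed_comp; last exact: closed_eq.
by move=> u _; apply: (@cvg_dot _ (nbhs u) _ id id); exact: cvg_id.
Qed.

Definition cube (r : R) : set 'rV[R]_d := [set p | `|p| <= r].

Lemma closed_cube r : closed (cube r).
Proof.
apply: (@closed_comp _ _ (fun p => `|p|) [set x | x <= r]).
  by move=> p _; exact: norm_continuous.
exact: closed_le.
Qed.

Lemma measurable_open (O : set 'rV[R]_d) :
  open O -> measurable (O : set (borel_rV R d)).
Proof. exact: sub_sigma_algebra. Qed.

Lemma measurable_closed (C : set 'rV[R]_d) :
  closed C -> measurable (C : set (borel_rV R d)).
Proof.
move=> clC; rewrite -(setCK C); apply: measurableC.
by apply: measurable_open; rewrite openC.
Qed.

Lemma measurable_halfspace u t :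
  measurable (halfspace u t : set (borel_rV R d)).
Proof. by apply: measurable_closed; exact: halfspace_closed. Qed.

End Euclid.

(** * Finite bracketing of halfspaces *)

Section Bracketing.
Context (R : realType) (d : nat) (mu : probability (borel_rV R d) R).

Lemma prob_tight (tau : R) : 0 < tau ->
  exists2 r : R, 0 < r & fine (mu (~` cube r)) <= tau.
Proof.
move=> tau0.
have mcube k : measurable (cube k.+1%:R : set (borel_rV R d)).
  by apply: measurable_closed; exact: closed_cube.
have cubeT : \bigcup_k cube k.+1%:R = [set: borel_rV R d].
  apply/seteqP; split => // p _; exists (Num.bound `|p|) => //.
  rewrite /cube/=; apply: ltW; apply: lt_le_trans (archi_boundP (normr_ge0 _)) _.
  by rewrite ler_nat.
have nd : nondecreasing_seq (fun k => cube k.+1%:R : set (borel_rV R d)).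
  move=> m n mn; apply/subsetPset => p; rewrite /cube/= => /le_trans; apply.
  by rewrite ler_nat.
have /fine_cvgP[_ /cvgrPdist_le/(_ _ tau0)[k _ /(_ k (leqnn k))/= hk]] :
    mu (cube k.+1%:R) @[k --> \oo] --> 1%:E.
  rewrite -(probability_setT mu) -cubeT; apply: nondecreasing_cvg_mu => //.
  by rewrite cubeT; exact: measurableT.
exists k.+1%:R => //.
rewrite probability_setC//.
rewrite fineB//; last exact: fin_num_measure.
exact: le_trans (ler_norm _) hk.
Qed.

(** Inside the cube, changing the direction and the offset by less than [del]
    shifts a halfspace by at most [rho], so the halfspaces with net direction
    and offset [t0 - rho], [t0 + rho] bracket it there; outside the cube the
    brackets are empty and full, at the cost of the mass outside. *)
Lemma halfspace_bracketing (L : R) :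
  (forall u, usphere u -> forall s t,
    `|fine (mu (halfspace u s)) - fine (mu (halfspace u t))| <= L * `|s - t|) ->
  forall eta : R, 0 < eta ->
  exists (I : choiceType) (s : seq I) (A B : I -> set 'rV[R]_d),
    (forall i, measurable (A i : set (borel_rV R d)) /\
               measurable (B i : set (borel_rV R d))) /\
    forall u t, usphere u -> exists i, [/\ i \in s, A i `<=` halfspace u t,
      halfspace u t `<=` B i & fine (mu (B i)) - fine (mu (A i)) <= eta].
Proof.
move=> lipL eta eta0.
have tau0 : 0 < eta / 4 by lra.
have [r r0 Pr] := prob_tight tau0.
pose D : R := d%:R * r + 1.
have D0 : 0 < D by rewrite /D ltr_wpDl// mulr_ge0// ltW.
(* Chosen so that moving the offset by [2 * rho] costs at most [eta / 2]; the
   two tails [eta / 4] make up the rest.  [Num.max L 1] keeps the division legal. *)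
pose del : R := eta / (4 * (Num.max L 1) * D).
have L1 : 0 < Num.max L 1 by rewrite lt_max ltr01 orbT.
have del0 : 0 < del by rewrite /del divr_gt0// !mulr_gt0.
pose rho : R := D * del.
have rhoE : Num.max L 1 * (2 * rho) = eta / 2.
  by rewrite /rho /del; field; rewrite !gt_eqF.
(* Inside the cube every projection lies in [-M, M]. *)
pose M : R := d%:R * r.
pose A (i : 'rV[R]_d * R) := halfspace i.1 (i.2 - rho) `&` cube r.
pose B (i : 'rV[R]_d * R) := halfspace i.1 (i.2 + rho) `|` ~` cube r.
have mH u t := @measurable_halfspace R d u t.
have mC : measurable (cube r : set (borel_rV R d)).
  by apply: measurable_closed; exact: closed_cube.
have mA i : measurable (A i : set (borel_rV R d)) by exact: measurableI.
have mB i : measurable (B i : set (borel_rV R d)).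
  by apply: measurableU => //; exact: measurableC.
have Fle (S1 S2 S3 : set (borel_rV R d)) : measurable S1 -> measurable S2 ->
    measurable S3 -> S1 `<=` S2 `|` S3 ->
    fine (mu S1) <= fine (mu S2) + fine (mu S3).
  move=> m1 m2 m3 S123.
  rewrite -fineD ?fin_num_measure//.
  apply: fine_le; rewrite ?fin_numD ?fin_num_measure//.
  apply: le_trans _ (measureU2 mu m2 m3).
  by apply: le_measure => //; rewrite inE//; exact: measurableU.
have := @compact_usphere R d.
rewrite compact_cover => /(_ _ (@usphere R d) (fun v => (ball v del)^°)).
case=> [v _|v v1|D1 D1K cov1]; first exact: open_interior.
  by exists v => //; exact: nbhsx_ballx.
have := @segment_compact R (- M) M.
rewrite compact_cover => /(_ _ `[- M, M]%classic (fun x => (ball x del)^°)).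
case=> [x _|x xM|D2 _ cov2]; first exact: open_interior.
  by exists x => //; exact: nbhsx_ballx.
exists ('rV[R]_d * R)%type, [seq (v, x) | v <- D1, x <- D2], A, B.
split=> // u t u1.
(* Clamping the offset does not change the trace of the halfspace on the cube
   up to its bounding hyperplane, and leaves a compact range to cover. *)
pose t' := Num.max (- M) (Num.min M t).
have M0 : 0 <= M by rewrite mulr_ge0// ltW.
have [u0 /= u0D1 /interior_subset ub] := cov1 u u1.
have [|t0 /= t0D2 /interior_subset tb] := cov2 t'.
  rewrite /= in_itv/= /t' le_max lexx/= ge_max ge_min lexx/=.
  by rewrite andbT; lra.
have u01 : usphere u0 by apply: set_mem; exact: D1K.
move: ub tb; rewrite -!ball_normE/= => ub tb.
have cubeH p : cube r p -> `|dot p u - dot p u0| <= d%:R * r * del.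
  move=> pr; rewrite ![dot p _]dotC -dotBl.
  apply: le_trans (norm_dot_le _ _) _; rewrite -mulrA ler_wpM2l//.
  by rewrite mulrC ler_pM// distrC ltW.
have cubeM p : cube r p -> `|dot p u| <= M.
  move=> pr; apply: le_trans (usphere_norm_dot_le p u1) _.
  by rewrite ler_wpM2l.
have rhoD : rho = d%:R * r * del + del by rewrite /rho /D mulrDl mul1r.
exists (u0, t0); split; first exact: allpairs_f.
- move=> p [/= + pr]; rewrite /halfspace/= => h.
  have := cubeH _ pr; have := cubeM _ pr; move: tb; rewrite /t'.
  rewrite ltr_norml !ler_norml => /andP[? ?] /andP[? ?] /andP[? ?].
  have : dot p u < t' by rewrite /t'; lra.
  rewrite /t' lt_max lt_min => /orP[|/andP[_ /ltW//]]; lra.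
- move=> p; rewrite /halfspace/= => h.
  have [pr|pr] := pselect (cube r p); [left|by right].
  have := cubeH _ pr; have := cubeM _ pr; move: tb.
  rewrite ltr_norml !ler_norml => /andP[? ?] /andP[? ?] /andP[? ?].
  have : dot p u <= t' by rewrite /t' le_max le_min h andbT; apply/orP; right.
  rewrite /halfspace/=; lra.
- have h1 : fine (mu (B (u0, t0))) <=
      fine (mu (halfspace u0 (t0 + rho))) + eta / 4.
    apply: le_trans (Fle _ (halfspace u0 (t0 + rho)) (~` cube r) _ _ _ _) _ => //.
      exact: measurableC.
    by rewrite lerD2l.
  have h2 : fine (mu (halfspace u0 (t0 - rho))) <=
      fine (mu (A (u0, t0))) + eta / 4.
    apply: le_trans (Fle _ (A (u0, t0)) (~` cube r) _ _ _ _) _ => //.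
    + exact: measurableC.
    + by move=> p hp; have [pr|pr] := pselect (cube r p); [left|right].
    + by rewrite lerD2l.
  have := lipL _ u01 (t0 + rho) (t0 - rho).
  have -> : `|t0 + rho - (t0 - rho)| = 2 * rho.
    by rewrite ger0_norm; [ring | rewrite rhoD; nra].
  have rho0 : 0 <= 2 * rho by rewrite mulr_ge0// mulr_ge0// ltW.
  have : L * (2 * rho) <= Num.max L 1 * (2 * rho).
    by rewrite ler_wpM2r// le_max lexx.
  rewrite rhoE ler_norml => ? /andP[? ?]; lra.
Qed.

End Bracketing.

(** * Uniform deviation over all halfspaces *)

Section Counts.
Context (U : Type) (n : nat) (x : 'I_n -> U).

Lemma count_in_le (A B : set U) :
  A `<=` B -> (count_in x A <= count_in x B)%N.
Proof.
move=> AB; apply/subset_leq_card/fintype.subsetP => i.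
by rewrite !unfold_in/= => /set_mem xA; exact/mem_set/AB.
Qed.

Lemma count_in_setC (A : set U) : (count_in x A + count_in x (~` A))%N = n.
Proof.
rewrite -[RHS](card_ord n) -(cardC [pred i : 'I_n | x i \in A]); congr addn.
apply: eq_card => i; rewrite -[LHS]/(x i \in ~` A) -[RHS]/(~~ (x i \in A)).
exact: classical_sets.in_setC.
Qed.

End Counts.

(** The lower bound is stated through the complement of [A], so that both
    hypotheses are upper tails. *)
Lemma bracket_deviation (R : realType) (U : Type) (n : nat) (x : 'I_n -> U)
    (A H B : set U) (a h b eps' eta : R) :
  (0 < n)%N -> A `<=` H -> H `<=` B -> a <= h <= b -> b - a <= eta ->
  (count_in x B)%:R <= n%:R * (b + eps') ->
  (count_in x (~` A))%:R <= n%:R * (1 - a + eps') ->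
  `|h - n%:R^-1 * (count_in x H)%:R| <= eta + eps'.
Proof.
move=> n0 AH HB /andP[ah hb] ba cB cA.
have n0' : 0 < n%:R :> R by rewrite ltr0n.
have c1 : (count_in x H)%:R <= (count_in x B)%:R :> R.
  by rewrite ler_nat count_in_le.
have c2 : (count_in x A)%:R <= (count_in x H)%:R :> R.
  by rewrite ler_nat count_in_le.
have c3 : (count_in x A)%:R + (count_in x (~` A))%:R = n%:R :> R.
  by rewrite -natrD count_in_setC.
set c : R := (count_in x H)%:R in c1 c2 *.
have u : c <= n%:R * (h + eta + eps').
  by apply: le_trans (le_trans c1 cB) _; rewrite ler_wpM2l//; lra.
have l : n%:R * (h - eta - eps') <= c.
  apply: le_trans c2.
  have : n%:R * (h - eta - eps') <= n%:R * (a - eps') by rewrite ler_wpM2l//; lra.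
  have e : n%:R * (1 - a + eps') = n%:R - n%:R * (a - eps') :> R by ring.
  by move: cA; rewrite e; lra.
have u' : n%:R^-1 * c <= h + eta + eps' by rewrite mulrC ler_pdivrMr// mulrC.
have l' : h - eta - eps' <= n%:R^-1 * c.
  by rewrite mulrC ler_pdivlMr// mulrC.
rewrite ler_norml; lra.
Qed.

Section UniformDeviation.
Context (R : realType) (dT : measure_display) (T : measurableType dT)
  (P : probability T R) (d : nat) (X : {RV P >-> borel_rV R d})
  (Xs : nat -> {RV P >-> borel_rV R d}).
Hypothesis X_proj : lipschitz_in_projection X.
Hypothesis Xs_indep : independent_RVs Xs.
Hypothesis Xs_law : forall i, equal_in_distribution (Xs i) X.

Let mu : probability (borel_rV R d) R := distribution P X.

Lemma uniform_halfspace_deviation (eps : R) : 0 < eps ->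
  exists C : R, 0 <= C /\ forall n : nat, (0 < n)%N -> exists E : set T,
    [/\ measurable E,
      ((1 - C * expR (- (2 * n%:R * eps ^+ 2)))%:E <= P E)%E &
      forall w u t, E w -> usphere u ->
        `|fine (mu (halfspace u t)) -
          n%:R^-1 * (count_in (fun i : 'I_n => Xs i w) (halfspace u t))%:R|
        <= eps].
Proof.
move=> eps0.
have [eps' eps'lt rate] := bernoulli_tail_rate eps0.
have eta0 : 0 < eps - eps' by rewrite subr_gt0.
have [L [_ lipL]] := X_proj.
have lipmu u : usphere u -> forall s t,
    `|fine (mu (halfspace u s)) - fine (mu (halfspace u t))| <= L * `|s - t|.
  by move=> u1 s t; exact: (lipL u u1 (s, t)).
have [I [s [A [B [mAB brk]]]]] := halfspace_bracketing lipmu eta0.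
have mA i : measurable (A i : set (borel_rV R d)) by case: (mAB i).
have mB i : measurable (B i : set (borel_rV R d)) by case: (mAB i).
exists (2 * (size s)%:R); split; first by rewrite mulr_ge0.
move=> n n0.
pose bad (S : set (borel_rV R d)) : set T :=
  [set w | n%:R * (fine (mu S) + eps') < (count_in (fun i : 'I_n => Xs i w) S)%:R].
have mbad S : measurable S -> measurable (bad S).
  by move=> mS; exact: measurable_count_tail.
have Pbad S : measurable S ->
    (P (bad S) <= (expR (- (2 * n%:R * eps ^+ 2)))%:E)%E.
  move=> mS.
  have law i : P (Xs i @^-1` S) = (fine (mu S))%:E.
    by rewrite fineK ?fin_num_measure//; exact: Xs_law.
  have s0 : 0 <= 4 * eps by lra.
  apply: le_trans (count_tail_le mS Xs_indep law (fine (mu S) + eps') n s0) _.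
  rewrite lee_fin (_ : - (2 * n%:R * eps ^+ 2) = n%:R * (- (2 * eps ^+ 2))); last by ring.
  rewrite (expRM_natl n) lerXn2r ?nnegrE ?expR_ge0//; last first.
    apply: rate; rewrite -!lee_fin fineK ?fin_num_measure//.
    by rewrite measure_ge0 probability_le1.
  apply: mulr_ge0; last exact: expR_ge0.
  have := expR_ge0 (4 * eps).
  have : 0 <= fine (mu S) <= 1.
    rewrite -!lee_fin fineK ?fin_num_measure//.
    by rewrite measure_ge0 probability_le1.
  by move=> /andP[? ?] ?; nra.
pose F i := bad (B i) `|` bad (~` A i).
have mF i : measurable (F i).
  by apply: measurableU; apply: mbad => //; exact: measurableC.
have mcF : measurable (\bigcup_(i in [set` s]) F i).
  by apply: fin_bigcup_measurable => // i _; exact: mF.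
exists (~` \bigcup_(i in [set` s]) F i); split; first exact: measurableC.
  rewrite probability_setC// EFinB leeB//.
  apply: le_trans (le_measure_bigsetU _ _ mF) _.
  apply: le_trans (_ : _ <= \sum_(i <- s)
      (2 * expR (- (2 * n%:R * eps ^+ 2)))%:E)%E _.
    apply: lee_sum => i _.
    apply: le_trans (measureU2 P (mbad _ (mB i)) (mbad _ (measurableC (mA i)))) _.
    by rewrite mulr_natl mulr2n EFinD leeD// Pbad//; exact: measurableC.
  rewrite sumEFin lee_fin big_const_seq count_predT iter_addr_0.
  by rewrite -mulr_natl; lra.
move=> w u t Ew u1.
have [i [si AH HB ba]] := brk u t u1.
have nF : ~ F i w by move=> Fw; apply: Ew; exists i.
have mH := measurable_halfspace u t.
have -> : eps = (eps - eps') + eps' by ring.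
apply: (bracket_deviation n0 AH HB _ ba).
- by apply/andP; split; apply: fine_le; rewrite ?fin_num_measure//;
    apply: le_measure => //; rewrite inE.
- by rewrite leNgt; apply/negP => h; apply: nF; left.
- rewrite leNgt; apply/negP => h; apply: nF; right; rewrite /bad/=.
  rewrite probability_setC// fineB ?fin_num_measure//.
Qed.

End UniformDeviation.

(** * Sample depth *)

Section HalfspacesAt.
Context (R : realType) (d : nat).
Implicit Types q u v : 'rV[R]_d.

Lemma halfspaces_atP q (H : set 'rV[R]_d) : halfspaces_at q H <->
  exists u t, [/\ usphere u, H = halfspace u t & dot q u <= t].
Proof.
split=> [[[u [c [u0 ->]]] /= qc]|[u [t [u1 -> qt]]]].
  have u0' : 0 < enorm u.
    by rewrite sqrtr_gt0 lt_neqAle eq_sym dot_eq0 u0 dot_ge0.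
  exists ((enorm u)^-1 *: u), ((enorm u)^-1 * c); split.
  - apply/usphereE; rewrite dotZr dotC dotZr mulrA -invfM -expr2 sqr_sqrtr ?dot_ge0//.
    by rewrite mulVf// dot_eq0.
  - apply/seteqP; split => p; rewrite /halfspace/= dotZr.
      by rewrite ler_pM2l// invr_gt0.
    by rewrite ler_pM2l// invr_gt0.
  - by rewrite dotZr ler_pM2l// invr_gt0.
split; last exact: qt.
exists u, t; split=> //; apply/eqP => u0.
move/usphereE : u1; rewrite u0 /dot big1 => [/eqP|i _]; last by rewrite mxE mul0r.
by rewrite eq_sym oner_eq0.
Qed.

Lemma halfspaces_at_nonempty q : (0 < d)%N -> halfspaces_at q !=set0.
Proof.
case: d q => // k q _.
pose u : 'rV[R]_k.+1 := delta_mx ord0 ord0.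
exists [set p | dot p u <= dot q u]; split=> //=.
exists u, (dot q u); split=> //.
by apply/eqP => /rowP/(_ ord0)/eqP; rewrite !mxE !eqxx oner_eq0.
Qed.

End HalfspacesAt.

Section SampleDepth.
Context (R : realType) (d n : nat).
Hypothesis d_gt0 : (0 < d)%N.
Implicit Types (q : 'rV[R]_d) (x : 'I_n -> 'rV[R]_d).

Let counts (x : 'I_n -> 'rV[R]_d) q : set R :=
  [set (count_in x H)%:R | H in halfspaces_at q].

Lemma counts_nonempty x q : counts x q !=set0.
Proof.
by have [H qH] := halfspaces_at_nonempty q d_gt0; exists (count_in x H)%:R, H.
Qed.

Lemma counts_lbound x q : lbound (counts x q) 0.
Proof. by move=> _ [H _ <-]. Qed.

Lemma HD_sampleE x q : HD_sample x q = n%:R^-1 * inf (counts x q).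
Proof. by []. Qed.

Lemma HD_sample_ge0 x q : 0 <= HD_sample x q.
Proof.
rewrite HD_sampleE mulr_ge0//; apply: lb_le_inf; first exact: counts_nonempty.
exact: counts_lbound.
Qed.

Lemma HD_sample_le x q H : halfspaces_at q H ->
  HD_sample x q <= n%:R^-1 * (count_in x H)%:R.
Proof.
move=> qH; rewrite HD_sampleE ler_wpM2l//; apply: ge_inf; last by exists H.
by exists 0; exact: counts_lbound.
Qed.

Lemma le_HD_sample x q c : (0 < n)%N ->
  (forall H, halfspaces_at q H -> c <= n%:R^-1 * (count_in x H)%:R) ->
  c <= HD_sample x q.
Proof.
move=> n0 h; rewrite HD_sampleE mulrC ler_pdivlMr ?ltr0n//.
apply: lb_le_inf; first exact: counts_nonempty.
by move=> _ [H qH <-]; rewrite -ler_pdivlMr ?ltr0n// mulrC; exact: h.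
Qed.

Lemma HD_sample_lt x q c : (0 < n)%N -> HD_sample x q < c ->
  exists2 H, halfspaces_at q H & n%:R^-1 * (count_in x H)%:R < c.
Proof.
move=> n0; rewrite HD_sampleE mulrC ltr_pdivrMr ?ltr0n// => h.
have [_ [H qH <-] Hc] := inf_lt (counts_nonempty x q) h.
by exists H => //; rewrite mulrC ltr_pdivrMr ?ltr0n.
Qed.

Lemma HD_sample_le1 x q : HD_sample x q <= 1.
Proof.
have [H qH] := halfspaces_at_nonempty q d_gt0.
apply: le_trans (HD_sample_le x qH) _.
have [n0|n0] := posnP n.
  have -> : n%:R^-1 = 0 :> R by rewrite n0 invr0.
  by rewrite mul0r.
rewrite mulrC ler_pdivrMr ?ltr0n// mul1r ler_nat -[leqRHS](card_ord n).
exact: max_card.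
Qed.

(** Translating a halfspace with few sample points so that [q] lies on its boundary keeps
    the sample points that are strictly outside outside, for all samples and
    points nearby, so the count cannot jump up. *)
Lemma HD_sample_usc (x0 : 'M[R]_(n, d)) q0 c : (0 < n)%N ->
  HD_sample (fun i => row i x0) q0 < c ->
  \forall z \near (x0, q0), HD_sample (fun i => row i z.1) z.2 < c.
Proof.
move=> n0 /(HD_sample_lt n0)[_ /halfspaces_atP[u [t [u1 -> qt]]] lc].
have far i : \forall z \near (x0, q0),
    row i x0 \in halfspace u (dot q0 u) \/
    dot z.2 u < dot (row i z.1) u.
  have [ix|] := boolP (row i x0 \in _).
    by apply: (@filterE _ (nbhs (x0, q0))) => z; left.
  rewrite notin_setE /halfspace/= => /negP; rewrite -ltNge -subr_gt0 => h.
  suff : (dot (row i z.1) u - dot z.2 u) @[z --> (x0, q0)] -->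
      (dot (row i x0) u - dot q0 u).
    move=> /cvgr_gt/(_ _ h); apply: filterS => z.
    by rewrite subr_gt0 => ?; right.
  apply: cvgB; last first.
    apply: (@cvg_dot _ _ _ _ _ snd (fun=> u)); [exact: cvg_snd | exact: cvg_cst].
  apply: cvg_big; first exact: add_continuous.
  move=> j _; apply: cvgMl; rewrite mxE.
  under eq_cvg do rewrite mxE.
  apply: (@cvg_comp _ _ _ fst (fun M : 'M[R]_(n, d) => M i j) _ _ _ cvg_fst).
  exact: coord_continuous.
apply: (@filterS _ (nbhs (x0, q0)) _ _ _ _
  (@filter_forall _ _ _ (nbhs (x0, q0)) _ far)) => z hz.
have qH : halfspaces_at z.2 (halfspace u (dot z.2 u)).
  by apply/halfspaces_atP; exists u, (dot z.2 u).
apply: le_lt_trans (HD_sample_le _ qH) (le_lt_trans _ lc).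
rewrite ler_wpM2l// ler_nat; apply/subset_leq_card/fintype.subsetP => i.
rewrite !unfold_in/= => /set_mem; rewrite /halfspace/= => zi.
have [/set_mem xi|] := hz i; last by rewrite ltNge zi.
by apply/mem_set; apply: le_trans xi qt.
Qed.

End SampleDepth.

(** * Population depth *)

Section PopulationDepth.
Context (R : realType) (dT : measure_display) (T : measurableType dT)
  (P : probability T R) (d : nat) (X : {RV P >-> borel_rV R d}).
Hypothesis d_gt0 : (0 < d)%N.
Implicit Types q : 'rV[R]_d.

Let mu : probability (borel_rV R d) R := distribution P X.

Lemma HD_ge0 q : 0 <= HD X q.
Proof.
have [H qH] := halfspaces_at_nonempty q d_gt0.
apply: lb_le_inf; first by exists (fine (mu H)), H.
by move=> _ [K _ <-]; rewrite fine_ge0.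
Qed.

Lemma HD_le q H : halfspaces_at q H -> HD X q <= fine (mu H).
Proof.
move=> qH; apply: ge_inf; last by exists H.
by exists 0 => _ [K _ <-]; rewrite fine_ge0.
Qed.

Lemma le_HD q c :
  (forall H, halfspaces_at q H -> c <= fine (mu H)) -> c <= HD X q.
Proof.
move=> h; apply: lb_le_inf; last by move=> _ [H qH <-]; exact: h.
by have [H qH] := halfspaces_at_nonempty q d_gt0; exists (fine (mu H)), H.
Qed.

Lemma HD_le1 q : HD X q <= 1.
Proof.
have [H qH] := halfspaces_at_nonempty q d_gt0.
apply: le_trans (HD_le qH) _.
have [u [t [_ -> _]]] := (halfspaces_atP _ _).1 qH.
have mH := measurable_halfspace u t.
by rewrite -lee_fin fineK ?fin_num_measure// probability_le1.
Qed.

Lemma HD_dist_le (n : nat) (x : 'I_n -> 'rV[R]_d) eps q : (0 < n)%N ->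
  (forall u t, usphere u -> `|fine (mu (halfspace u t)) -
    n%:R^-1 * (count_in x (halfspace u t))%:R| <= eps) ->
  `|HD X q - HD_sample x q| <= eps.
Proof.
move=> n0 dev.
have devH H : halfspaces_at q H ->
    `|fine (mu H) - n%:R^-1 * (count_in x H)%:R| <= eps.
  by move=> /halfspaces_atP[u [t [u1 -> _]]]; exact: dev.
rewrite ler_norml; apply/andP; split.
  suff : HD_sample x q - eps <= HD X q by lra.
  apply: le_HD => H qH; have := devH _ qH; have := HD_sample_le x qH.
  by rewrite ler_norml => ? /andP[? ?]; lra.
suff : HD X q - eps <= HD_sample x q by lra.
apply: le_HD_sample => // H qH; have := devH _ qH; have := HD_le qH.
by rewrite ler_norml => ? /andP[? ?]; lra.
Qed.

Hypothesis X_proj : lipschitz_in_projection X.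

(** A halfspace at [q] shifted along its normal by [dot (p - q) u] is a
    halfspace at [p], and its probability changes by at most [L] times the
    shift; the factor [d] compares Euclidean and max norms. *)
Lemma HD_lipschitz : exists2 L : R, 0 < L &
  forall p q, HD X p <= HD X q + L * `|p - q|.
Proof.
have [L [L0 lipL]] := X_proj.
exists (L * d%:R); first by rewrite mulr_gt0// ltr0n.
move=> p q; rewrite -lerBlDr; apply: le_HD => H /halfspaces_atP[u [t [u1 -> qt]]].
have pH : halfspaces_at p (halfspace u (t + (dot p u - dot q u))).
  by apply/halfspaces_atP; eexists; eexists; split; [exact: u1| by [] | lra].
have := HD_le pH.
have /= := lipL u u1 (t + (dot p u - dot q u), t) (conj I I).
rewrite -dotBl addrAC subrr add0r => lip.
have := usphere_norm_dot_le (p - q) u1.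
rewrite -(ler_pM2l L0) mulrA => le1.
have cdfE s : proj_cdf X u s = fine (mu (halfspace u s)) by [].
have := le_trans lip le1; rewrite !cdfE /mu.
by rewrite ler_norml => /andP[_]; lra.
Qed.

Lemma HD_continuous : continuous (fun q => HD X q).
Proof.
have [L L0 lip] := HD_lipschitz.
move=> q; apply/(@cvgrPdist_lt _ _ _ (nbhs q)) => e e0.
have e1 : 0 < e / L by rewrite divr_gt0.
have : \forall p \near q, `|q - p| < e / L.
  by apply/nbhs_ballP; exists (e / L) => //= p; rewrite -ball_normE.
apply: filterS => p qp.
have := lip p q; have := lip q p; rewrite (distrC p q) => h1 h2.
have h3 : L * `|q - p| < e by rewrite mulrC -ltr_pdivlMr.
by rewrite ltr_norml; lra.
Qed.

End PopulationDepth.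

(** * Measurability of the deviation event *)

Section Measurability.
Context (R : realType) (dT : measure_display) (T : measurableType dT)
  (P : probability T R) (d : nat) (X : {RV P >-> borel_rV R d})
  (Xs : nat -> {RV P >-> borel_rV R d}).
Hypothesis d_gt0 : (0 < d)%N.
Hypothesis X_proj : lipschitz_in_projection X.

(** The sample as one matrix, so that events about it can be treated as open and
    closed sets of a single finite-dimensional space. *)
Definition sample_mx (n : nat) (w : T) : 'M[R]_(n, d) :=
  \matrix_(i < n, j < d) Xs i w ord0 j.

Lemma row_sample_mx n w :
  (fun i => row i (sample_mx n w)) = (fun i : 'I_n => Xs i w).
Proof. by apply/funext => i; apply/rowP => j; rewrite !mxE. Qed.

(** An open set of matrices is a countable union of max-norm balls with rational
    center, and the preimage of such a ball is a finite intersection of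
    events about single coordinates. *)
Lemma measurable_sample_mx_open n (O : set 'M[R]_(n, d)) :
  open O -> measurable (sample_mx n @^-1` O).
Proof.
move=> oO.
pose box (i : 'M[rat]_(n, d) * nat) : set 'M[R]_(n, d) :=
  ball (map_mx ratr i.1 : 'M[R]_(n, d)) i.2.+1%:R^-1.
have -> : O = \bigcup_i (if `[< box i `<=` O >] then box i else set0).
  apply/seteqP; split => [x Ox|x [i _]]; last by case: asboolP => // + ?; exact.
  have [e e0 xe] : exists2 e : R, 0 < e & ball x e `<=` O.
    by have /nbhs_ballP[e /= e0 xe] : nbhs x O by [exact: open_nbhs_nbhs]; exists e.
  have [k ke] : exists k : nat, k.+1%:R^-1 < e / 2 :> R.
    have e2 : 0 < e / 2 by lra.
    have [k _ /(_ k (leqnn k))] := near_infty_natSinv_lt (PosNum e2).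
    by exists k.
  have k0 : 0 < k.+1%:R^-1 :> R by rewrite invr_gt0.
  have ex i j : exists c : rat, `|ratr c - x i j| < k.+1%:R^-1.
    have [|c] := @rat_in_itvoo R (x i j - k.+1%:R^-1) (x i j + k.+1%:R^-1).
      by rewrite ltrD2l gtrN.
    rewrite in_itv/= => /andP[xc cx]; exists c.
    by rewrite ltr_norml; apply/andP; split; [rewrite ltrBrDl | rewrite ltrBlDl].
  pose c : 'M[rat]_(n, d) := \matrix_(i, j) xchoose (ex i j).
  have cx : box (c, k) x.
    split=> // i j; rewrite !mxE -ball_normE/=; exact: (xchooseP (ex i j)).
  exists (c, k) => //; case: asboolP => // -[] y cy; apply: xe.
  have ke' : k.+1%:R^-1 + k.+1%:R^-1 <= e :> R by rewrite [leRHS]splitr lerD// ltW.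
  by apply: le_ball ke' _ _; apply: ball_triangle cy; exact: ball_sym.
rewrite preimage_bigcup; apply: countable_bigcupT_measurable => // i.
case: asboolP => _; last by rewrite preimage_set0.
have -> : sample_mx n @^-1` box i = \bigcap_(ab in [set: 'I_n * 'I_d])
    Xs ab.1 @^-1` [set p | ball (ratr (i.1 ab.1 ab.2) : R) i.2.+1%:R^-1 (p ord0 ab.2)].
  apply/seteqP; split => [w [_ h] [a b] _|w h] /=.
    by have := h a b; rewrite !mxE.
  by split=> // a b; rewrite !mxE; exact: (h (a, b) I).
apply: fin_bigcap_measurable => // -[a b] _ /=.
apply: measurable_funPTI => //; apply: measurable_open.
apply: (@open_comp _ _ (fun p : 'rV[R]_d => p ord0 b)).
  by move=> p _; exact: coord_continuous.
exact: ball_open.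
Qed.

(** Both one-sided conditions reduce to open sets of samples: [B1], where some
    point has too small a sample depth, and [G2 k], where no point of the cube
    of radius [k] has a sample depth exceeding the population depth by
    [eps + 1 / (k + 1)] or more.  The second is open because the universal
    quantifier runs over a compact set. *)
Lemma measurable_depth_deviation (n : nat) (eps : R) : (0 < n)%N ->
  measurable [set w | forall q,
    `|HD X q - HD_sample (fun i : 'I_n => Xs i w) q| <= eps].
Proof.
move=> n0.
have [del delE] : exists del : nat -> R, forall k, del k = k.+1%:R^-1.
  by exists (fun k => k.+1%:R^-1).
pose hd (x : 'M[R]_(n, d)) q := HD_sample (fun i => row i x) q.
pose B1 : set 'M[R]_(n, d) := [set x | exists q, hd x q < HD X q - eps].
pose G2 (k : nat) : set 'M[R]_(n, d) := [set x | forall q, cube k%:R q ->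
  hd x q < HD X q + (eps + del k)].
have oB1 : open B1.
  rewrite openE => x0 [q /(HD_sample_usc d_gt0 n0)].
  move=> [[A B]/= [xA qB]] sub.
  apply: filterS xA => x Ax; exists q; apply: (sub (x, q)); split => //=.
  exact: nbhs_singleton.
have oG2 k : open (G2 k).
  rewrite openE => x0 G2x0.
  have ck : compact (cube k%:R : set 'rV[R]_d).
    apply: bounded_closed_compact; last exact: closed_cube.
    exists k%:R; split; first exact: num_real.
    by move=> r kr p pk; exact: le_trans pk (ltW kr).
  move/compact_near_coveringP : ck.
  move=> /(_ _ (nbhs x0) (fun x q => hd x q < HD X q + (eps + del k))).
  apply => q kq; have hq : hd x0 q < HD X q + (eps + del k) by exact: G2x0.
  (* Semicontinuity moves [hd] and continuity moves [HD X], each up to [c]. *)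
  pose c := (hd x0 q + (HD X q + (eps + del k))) / 2.
  have h1 : hd x0 q < c by rewrite /c; lra.
  have h2 : c - (eps + del k) < HD X q by rewrite /c; lra.
  have [[A B]/= [xA qB] sub] := HD_sample_usc d_gt0 n0 h1.
  have qB' : nbhs q [set p | c - (eps + del k) < HD X p].
    exact: (@cvgr_gt _ _ (nbhs q) _ _ _ (HD_continuous d_gt0 X_proj (x := q)) _ h2).
  exists (B `&` [set p | c - (eps + del k) < HD X p], A) => /=.
    by split=> //; exact: filterI.
  move=> [p x]/= [[Bp pc] Ax].
  by have := sub (x, p) (conj Ax Bp); rewrite /hd/=; lra.
rewrite (_ : [set w | _] = ~` (sample_mx n @^-1` B1) `&`
   \bigcap_k (sample_mx n @^-1` G2 k)); last first.
  apply/seteqP; split => w /=.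
    move=> h; split=> [[q]|k _ q kq]; rewrite /hd row_sample_mx;
      have := h q; rewrite ler_norml => /andP[? ?]; first lra.
    have : 0 < del k by rewrite delE invr_gt0.
    lra.
  move=> [nB1 hG2] q; rewrite ler_norml; apply/andP; split; last first.
    rewrite leNgt; apply/negP => h; apply: nB1; exists q.
    by rewrite /hd row_sample_mx; lra.
  suff : HD_sample (fun i : 'I_n => Xs i w) q - HD X q - eps <= 0 by lra.
  apply/ler_addgt0Pr => e e0; rewrite add0r.
  have [k1 _ hk1] := near_infty_natSinv_lt (PosNum e0).
  pose k := maxn k1 (Num.bound `|q|).
  have ke : del k < e by rewrite delE; apply: hk1; rewrite /= leq_maxl.
  have qk : cube k%:R q.
    rewrite /cube/=; apply: ltW; apply: lt_le_trans (archi_boundP (normr_ge0 _)) _.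
    by rewrite ler_nat leq_maxr.
  have := hG2 k I q qk; rewrite /hd row_sample_mx; lra.
apply: measurableI.
  by apply: measurableC; exact: measurable_sample_mx_open.
by apply: bigcapT_measurable => k; exact: measurable_sample_mx_open.
Qed.

Lemma sup_depth_deviationE (n : nat) (eps : R) : (0 < n)%N ->
  [set w | sup [set `|HD X q - HD_sample (fun i : 'I_n => Xs i w) q|
     | q in [set: 'rV[R]_d]] <= eps] =
  [set w | forall q, `|HD X q - HD_sample (fun i : 'I_n => Xs i w) q| <= eps].
Proof.
move=> n0; apply/seteqP; split => w /= h.
  move=> q; apply: le_trans h; apply: ub_le_sup; last by exists q.
  exists 1 => _ [p _ <-].
  have := HD_ge0 X d_gt0 p; have := HD_le1 X d_gt0 p.
  have := HD_sample_ge0 d_gt0 (fun i : 'I_n => Xs i w) p.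
  have := HD_sample_le1 d_gt0 (fun i : 'I_n => Xs i w) p.
  by rewrite ler_norml; lra.
apply: ge_sup; first by exists `|HD X 0 - HD_sample (fun i : 'I_n => Xs i w) 0|, 0.
by move=> _ [q _ <-]; exact: h.
Qed.

End Measurability.

(** * Uniform concentration of halfspace depth *)

Theorem theorem1p2 (R : realType) (dT : measure_display)
    (T : measurableType dT) (P : probability T R) (d : nat) (d_gt1 : (1 < d)%N)
    (X : {RV P >-> borel_rV R d}) (Xs : nat -> {RV P >-> borel_rV R d})
    (X_decay : decays_quickly X)
    (X_proj : lipschitz_in_projection X)
    (X_radial : radially_lipschitz X)
    (Xs_indep : independent_RVs Xs)
    (Xs_law : forall i, equal_in_distribution (Xs i) X)
    (eps : R) (eps_gt0 : 0 < eps) :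
  exists (C : R) (N : nat), forall n : nat, (N <= n)%N ->
    ((1 - C * n%:R `^ (3 / 2 * (d%:R - 1)) * expR (- (2 * n%:R * eps ^+ 2)))%:E
     <= P [set w | (sup [set `|HD X q - HD_sample (fun i : 'I_n => Xs i w) q|
                        | q in [set: 'rV[R]_d]] <= eps)%R])%E.
Proof.
have d_gt0 : (0 < d)%N by exact: ltnW.
have [C [C0 dev]] := uniform_halfspace_deviation X_proj Xs_indep Xs_law eps_gt0.
exists C, 1%N => n n_gt0.
have [E [mE PE devE]] := dev n n_gt0.
have mG := measurable_depth_deviation Xs d_gt0 X_proj eps n_gt0.
rewrite (sup_depth_deviationE X Xs d_gt0 eps n_gt0).
apply: (@le_trans _ _ (P E)); last first.
  apply: le_measure; rewrite ?inE// => w Ew q.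
  by apply: HD_dist_le => // u t u1; exact: devE.
apply: le_trans PE; rewrite lee_fin lerD2l lerN2 ler_wpM2r ?expR_ge0//.
rewrite ler_peMr// -[leLHS](powRr0 n%:R) ler_powR ?ler1n//.
by rewrite mulr_ge0// subr_ge0 ler1n ltnW.
Qed.
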